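(* Let $d\ge 1$ and $m\ge 2$ be integers, let $\mathcal{D}_F=\{\mathbf{j}_1,\dots,\mathbf{j}_r\}\subset\{0,1,\dots,m-1\}^d$, and let $F\subset\mathbb{R}^d$ be the $d$-dimensional fractal cube determined by $m$ and $\mathcal{D}_F$. Then $F$ satisfies the maximal power law if and only if $F$ has trivial points (i.e. there is at least one $z\in F$ such that $\{z\}$ is a connected component of $F$).
   Context: Fractal cube: for $m\ge2$ and $\mathcal{D}_F=\{\mathbf{j}_1,\dots,\mathbf{j}_r\}\subset\{0,1,\dots,m-1\}^d$, set $\varphi_{\mathbf{j}}(y)=\frac1m(y+\mathbf{j})$ for $\mathbf{j}\in\mathcal{D}_F$, $y\in\mathbb{R}^d$. The fractal cube $F=F(m,\mathcal{D}_F)$ is the unique non-empty compact set with $F=\bigcup_{\mathbf{j}\in\mathcal{D}_F}\varphi_{\mathbf{j}}(F)$. It carries the Euclidean metric. $\delta$-connected components: for a metric space $(X,\rho)$ and $\delta>0$, two points $x,y\in X$ are $\delta$-equivalent if there is a finite sequence $x=x_1,x_2,\dots,x_k=y$ in $X$ with $\rho(x_i,x_{i+1})\le\delta$ for $1\le i\le k-1$. An equivalence class is called a $\delta$-connected component of $X$, and $h_X(\delta)$ denotes the number of $\delta$-connected components of $X$. Maximal power law: let $\gamma>0$. A compact metric space $X$ satisfies the power law with index $\gamma$ if $h_X(\delta)\asymp\delta^{-\gamma}$, i.e. there is a constant $c>1$ with $c^{-1}\delta^{-\gamma}\le h_X(\delta)\le c\,\delta^{-\gamma}$ for all $\delta\in(0,1)$.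 If in addition $\gamma=\dim_B X$ (the box-counting dimension), $X$ satisfies the maximal power law.
   Formalization: The theorem assumes r ≥ 2 digits: for r = 1 the cube F is a single point, which has a trivial point, but h_F(δ) = 1 satisfies no power law with index γ > 0, so the stated equivalence fails there. *)

(* Defs.v *)
From HB Require Import structures.
From mathcomp Require Import all_boot all_order all_algebra.
From mathcomp Require Import all_classical all_reals all_analysis.
Import Order.TTheory GRing.Theory Num.Theory.
Import numFieldNormedType.Exports.

Set Implicit Arguments.
Unset Strict Implicit.
Unset Printing Implicit Defensive.

Local Open Scope classical_set_scope.
Local Open Scope ring_scope.

(* The norm MathComp-Analysis puts on 'rV[R]_d is the sup norm; its topology
   is the usual one, but the metric of the fractal cube is the Euclidean one. *)
Definition eucl_dist (R : realType) (d : nat) (x y : 'rV[R]_d) : R :=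
  Num.sqrt (\sum_(i < d) (x 0 i - y 0 i) ^+ 2).

Section PowerLaw.
Variables (R : realType) (T : choiceType).
Variables (rho : T -> T -> R) (X : set T).

(* The points of the chain are u 0, ..., u k. *)
Definition delta_equiv (delta : R) (x y : T) : Prop :=
  exists (k : nat) (u : nat -> T),
    [/\ u 0%N = x, u k = y,
        forall i, (i <= k)%N -> X (u i) &
        forall i, (i < k)%N -> rho (u i) (u i.+1) <= delta].

Definition delta_components (delta : R) : set (set T) :=
  [set [set y | delta_equiv delta x y] | x in X].

Definition num_components (delta : R) : \bar R :=
  counting (delta_components delta).

Definition power_law (gamma : R) : Prop :=
  exists2 c : R, 1 < c &
    forall delta : R, 0 < delta < 1 ->
      ((c^-1 * delta `^ (- gamma))%:E <= num_components delta)%E /\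
      (num_components delta <= (c * delta `^ (- gamma))%:E)%E.

Definition covered_by (delta : R) (n : nat) : Prop :=
  exists U : 'I_n -> set T,
    (forall i x y, U i x -> U i y -> rho x y <= delta) /\
    X `<=` \bigcup_i U i.

(* The least number of sets of diameter at most delta covering X; it is +oo
   when no finite family does. *)
Definition covering_number (delta : R) : \bar R :=
  ereal_inf [set n%:R%:E | n in [set n : nat | covered_by delta n]].

(* Existence of the limit is part of this predicate. *)
Definition has_box_dim (s : R) : Prop :=
  (lne (covering_number delta) * ((- ln delta)^-1)%:E)%E
    @[delta --> 0^'+] --> s%:E.

Definition maximal_power_law : Prop :=
  exists gamma : R, [/\ 0 < gamma, power_law gamma & has_box_dim gamma].

End PowerLaw.

Section FractalCube.
Variables (R : realType) (d m : nat).

Definition cube_map (j : 'rV['I_m]_d) (y : 'rV[R]_d) : 'rV[R]_d :=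
  m%:R^-1 *: (y + \row_i (j 0 i : nat)%:R).

(* For 1 < m and D nonempty exactly one set F satisfies this (Hutchinson). *)
Definition is_fractal_cube (D : {set 'rV['I_m]_d}) (F : set 'rV[R]_d) : Prop :=
  [/\ F !=set0, compact F &
      F = \bigcup_(j in [set j | j \in D]) (cube_map j @` F)].

End FractalCube.

Definition has_trivial_point (T : topologicalType) (X : set T) : Prop :=
  exists2 z, X z & connected_component X z = [set z].

(* Main.v *)
(* Words of length n over D address the cubes of side m^-n covering F. If every
   point of F lies in a nontrivial component, then each delta-component crosses
   the middle half of the cube along some axis, hence contains about 1/delta
   points that are delta-apart; the covering number is thus at least of order
   h(delta)/delta, so the box dimension exceeds by one the index of any power
   law. If F has a trivial point, some small piece E of F, at positive distance
   from the rest of F, stays away from one of each two opposite faces of the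
   unit cube. Choose such an E approaching as few faces as possible. Were a
   digit to leave one of these faces, minimality would make every cube of the
   n-th approximation that is off the faces touch another cube one step closer
   to them; walking down to the faces, and up again from the neighbouring cube
   of the previous level, one would stay inside E and reach the opposite face.
   So the digits are constant in the directions of these faces, all the copies
   phi_w(E) are isolated in F at distance of order m^-n, and there are |D|^n of
   them: this is the lower bound of the power law, the upper one being the
   trivial covering by |D|^n cubes. *)

Require Import Defs.
From mathcomp Require Import all_boot all_order all_algebra.
From mathcomp Require Import finmap.
From mathcomp Require Import all_classical all_reals all_analysis.
From mathcomp Require Import zify ring lra.
Import Order.TTheory GRing.Theory Num.Theory.
Import numFieldNormedType.Exports.

Set Implicit Arguments.
Unset Strict Implicit.
Unset Printing Implicit Defensive.

Local Open Scope classical_set_scope.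
Local Open Scope ring_scope.

(** * Bounds on the counting measure by finite families *)

Section Counting.
Variables (R : realType) (T : choiceType).
Implicit Types A : set T.

Lemma counting_le (n : nat) (f : 'I_n -> T) A : A `<=` range f ->
  (counting A <= n%:R%:E :> \bar R)%E.
Proof.
move=> Af.
have finf : finite_set (range f) by apply: finite_image; exact: finite_finset.
have finA := sub_finite_set Af finf.
rewrite /counting asboolT // lee_fin ler_nat.
have sub : (fset_set A `<=` [fset f i | i in 'I_n])%fset.
  apply/fsubsetP => x; rewrite in_fset_set // inE => /Af[i _ <-].
  by apply/imfsetP; exists i.
apply: leq_trans (fsubset_leq_card sub) _.
apply: leq_trans (leq_imfset_card _ _ _) _ => //=.
by rewrite size_enum_ord.
Qed.

Lemma counting_ge (I : finType) (g : I -> T) A : injective g ->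
  (forall i, A (g i)) -> (#|I|%:R%:E <= counting A :> \bar R)%E.
Proof.
move=> ginj Ag; rewrite /counting; case: asboolP => [finA|_]; last exact: leey.
rewrite lee_fin ler_nat.
have <- : #|` [fset g i | i in I]%fset| = #|I|.
  by rewrite card_imfset //= cardE.
apply: fsubset_leq_card; apply/fsubsetP => x /imfsetP[i _ ->].
by rewrite in_fset_set // inE; exact: Ag.
Qed.

Lemma counting_enum A : finite_set A -> exists h (g : 'I_h -> T),
  [/\ injective g, forall i, A (g i) & counting A = h%:R%:E :> \bar R].
Proof.
move=> finA; exists #|` fset_set A|, (tnth (in_tuple (fset_set A))); split.
- by apply/tuple_uniqP; exact: fset_uniq.
- by move=> i; have := mem_tnth i (in_tuple (fset_set A)); rewrite in_fset_set // inE.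
- by rewrite /counting asboolT.
Qed.

End Counting.

(** * Chains, their equivalence classes, and coverings *)

Section Chains.
Variables (R : realType) (T : choiceType) (rho : T -> T -> R) (X : set T).
Hypothesis rho_sym : forall x y, rho x y = rho y x.
Local Notation equiv := (delta_equiv rho X).

Lemma delta_equiv_mem d x y : equiv d x y -> X x /\ X y.
Proof. by case=> k [u [<- <- Xu _]]; split; apply: Xu. Qed.

Lemma delta_equiv_step d x y : X x -> X y -> rho x y <= d -> equiv d x y.
Proof.
by move=> Xx Xy xy; exists 1%N, (fun i => if i is 0%N then x else y);
  split=> // [[|[|i]]|[|i]].
Qed.

Lemma delta_equiv_refl d x : X x -> equiv d x x.
Proof. by move=> Xx; exists 0%N, (fun=> x). Qed.

Lemma delta_equiv_sym d x y : equiv d x y -> equiv d y x.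
Proof.
case=> k [u [<- <- Xu du]]; exists k, (fun i => u (k - i)%N).
split; rewrite ?subn0 ?subnn //; first by move=> i ik; apply: Xu; exact: leq_subr.
move=> i ik; rewrite rho_sym.
have -> : (k - i = (k - i.+1).+1)%N by lia.
by apply: du; lia.
Qed.

Lemma delta_equiv_trans d x y z : equiv d x y -> equiv d y z -> equiv d x z.
Proof.
case=> k [u [<- uk Xu du]] [l [v [v0 <- Xv dv]]].
exists (k + l)%N, (fun i => if (i <= k)%N then u i else v (i - k)%N); split=> //.
- case: leqP => [kl|]; last by rewrite addKn.
  have -> : l = 0%N by lia.
  by rewrite addn0 uk v0.
- by move=> i ikl; case: leqP => ik; [apply: Xu|apply: Xv; lia].
move=> i ikl; case: (leqP i.+1 k) => ik; case: (leqP i k) => ik'; try lia.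
- exact: du.
- have -> : i = k by lia.
  by rewrite uk -v0 subSnn; apply: dv; lia.
- by rewrite subSn; [apply: dv; lia|lia].
Qed.

Lemma delta_equiv_le d d' x y : d <= d' -> equiv d x y -> equiv d' x y.
Proof.
move=> dd' [k [u [ux uy Xu du]]]; exists k, u; split=> // i ik.
exact: le_trans (du i ik) dd'.
Qed.

Lemma delta_equiv_closed d (A : set T) x y :
  (forall p q, A p -> X q -> rho p q <= d -> A q) ->
  A x -> equiv d x y -> A y.
Proof.
move=> Acl Ax [k [u [ux <- Xu du]]].
suff H i : (i <= k)%N -> A (u i) by apply: H.
elim: i => [|i IH] ik; first by rewrite ux.
by apply: Acl (IH (ltnW ik)) (Xu _ ik) (du _ ik).
Qed.

Lemma delta_component_eq d x y : X y ->
  [set z | equiv d x z] = [set z | equiv d y z] -> equiv d x y.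
Proof.
by move=> Xy e; have : [set z | equiv d x z] y; [rewrite e; exact: delta_equiv_refl|].
Qed.

Lemma delta_component_class d x y : equiv d x y ->
  [set z | equiv d x z] = [set z | equiv d y z].
Proof.
move=> xy; apply/seteqP; split=> z /=; last exact: delta_equiv_trans.
by apply: delta_equiv_trans; exact: delta_equiv_sym.
Qed.

(** Points of [X] in one set of the cover are one step apart, so each [U k] meets at most one
    component. If [U k] misses [X], then [f k] is empty, which is harmless for an inclusion. *)
Lemma components_sub_cover d n : Defs.covered_by rho X d n ->
  exists f : 'I_n -> set T, delta_components rho X d `<=` range f.
Proof.
move=> [U [dU XU]].
exists (fun k => [set y | exists2 x, X x /\ U k x & equiv d x y]).
move=> _ [x Xx <-]; have [k _ Ukx] := XU _ Xx; exists k => //.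
apply/seteqP; split=> y /=; last by exists x.
case=> z [Xz Ukz]; apply: delta_equiv_trans.
by apply: delta_equiv_step => //; exact: dU Ukx Ukz.
Qed.

Lemma num_components_le_cover d n : Defs.covered_by rho X d n ->
  (num_components rho X d <= n%:R%:E)%E.
Proof. by case/components_sub_cover => f; exact: counting_le. Qed.

(** A set of diameter at most [d] holds at most one of all the chosen points: two in one component
    are too far apart, two in different components would be equivalent. *)
Lemma num_components_mul_le_cover d n M : Defs.covered_by rho X d n ->
  (forall x, X x -> exists p : 'I_M -> T, (forall t, equiv d x (p t)) /\
     forall t t', t != t' -> d < rho (p t) (p t')) ->
  (num_components rho X d * M%:R%:E <= n%:R%:E)%E.
Proof.
move=> cov sep; have [f subf] := components_sub_cover cov.
have fin : finite_set (delta_components rho X d).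
  by apply: sub_finite_set subf _; apply: finite_image; exact: finite_finset.
have [h [g [ginj gcomp hE]]] := counting_enum R fin.
rewrite /num_components hE -EFinM lee_fin -natrM ler_nat.
have /choice[P HP] : forall c, exists p : 'I_M -> T,
    [/\ forall t, X (p t), forall t, g c = [set z | equiv d (p t) z] &
        forall t t', t != t' -> d < rho (p t) (p t')].
  move=> c; have [x Xx <-] := gcomp c; have [p [xp pp]] := sep x Xx.
  exists p; split=> // t; first by case: (delta_equiv_mem (xp t)).
  exact: delta_component_class.
have [U [dU XU]] := cov.
have /choice[K HK] : forall ct : 'I_h * 'I_M, exists k, U k (P ct.1 ct.2).
  move=> [c t]; have [Xp _ _] := HP c.
  by have [k _ Uk] := XU _ (Xp t); exists k.
rewrite -[h]card_ord -[M in (_ * M)%N]card_ord -card_prod -[n]card_ord.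
apply: (@leq_card _ _ K) => -[c t] [c' t'] eK.
have := HK (c, t); have := HK (c', t'); rewrite -eK /= => U' U1.
have dpp := dU _ _ _ U1 U'.
have [Xp gp sp] := HP c; have [Xp' gp' _] := HP c'.
have cc' : c = c'.
  apply: ginj; rewrite (gp t) (gp' t'); apply: delta_component_class.
  exact: delta_equiv_step.
subst c'; congr (_, _); apply/eqP; apply: contraLR isT => tt'.
by have := sp _ _ tt'; rewrite ltNge dpp.
Qed.

End Chains.

(** * Euclidean chains, quasi-components and connected components *)

Section Euclid.
Variables (R : realType) (d : nat).
Implicit Types (x y z p : 'rV[R]_d) (F : set 'rV[R]_d).
Local Notation dist := (@eucl_dist R d).

Lemma eucl_dist_sym x y : dist x y = dist y x.
Proof. by congr Num.sqrt; apply: eq_bigr => i _; rewrite -sqrrN opprB. Qed.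

Lemma coord_le_eucl x y i : `|x 0 i - y 0 i| <= dist x y.
Proof.
rewrite -sqrtr_sqr ler_sqrt; last by apply: sumr_ge0 => j _; exact: sqr_ge0.
by rewrite (bigD1 i) //= lerDl; apply: sumr_ge0 => j _; exact: sqr_ge0.
Qed.

Lemma eucl_le x y e : 0 <= e -> (forall i, `|x 0 i - y 0 i| <= e) ->
  dist x y <= d%:R * e.
Proof.
move=> e0 xy; have de0 : 0 <= d%:R * e by rewrite mulr_ge0.
rewrite -[leRHS]ger0_norm // -sqrtr_sqr ler_sqrt ?sqr_ge0 //.
apply: (@le_trans _ _ (\sum_(i < d) e ^+ 2)).
  apply: ler_sum => i _; rewrite -real_normK ?num_real //.
  by rewrite ler_pXn2r ?nnegrE.
rewrite sumr_const card_ord -[leLHS]mulr_natl exprMn.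
apply: ler_wpM2r; first exact: sqr_ge0.
by rewrite -natrX ler_nat; case: (d) => // k; rewrite -mulnn leq_pmulr.
Qed.

Lemma compact_seq_cluster F (u : nat -> 'rV[R]_d) : compact F ->
  (forall n, F (u n)) -> exists2 p, F p &
  forall e N, 0 < e -> exists2 n, (N <= n)%N & forall i, `|p 0 i - u n 0 i| < e.
Proof.
move=> cF Fu; have [|p [Fp clp]] := cF (u @ \oo) _; first by exists 0%N => // n _; exact: Fu.
exists p => // e N e0.
have [|_ [[n Nn <-] [_ B]]] :=
  clp [set u n | n in [set n | N <= n]%N] (ball p e) _ (nbhsx_ballx p e e0).
  by exists N => // n /= Nn; exists n.
by exists n => // i; exact: B.
Qed.

Lemma invS_lt (e : R) : 0 < e -> exists N, forall n, (N <= n)%N -> n.+1%:R^-1 < e.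
Proof.
move=> e0; exists (Num.truncn e^-1) => n Nn.
rewrite -[ltRHS]invrK ltf_pV2 ?posrE ?invr_gt0 //.
by apply: lt_le_trans (truncnS_gt _) _; rewrite ler_nat ltnS.
Qed.

(* [quasi F z] is the quasi-component of [z] in the compact set [F]. *)
Definition quasi F z := [set y | F y /\ forall e, 0 < e -> delta_equiv dist F e z y].

(** For a suitable large [n] the point [u n] is reached by [e]-steps, and one more step leads to
    [p]. *)
Lemma quasi_cluster F z p (u : nat -> 'rV[R]_d) : F p ->
  (forall n, delta_equiv dist F n.+1%:R^-1 z (u n)) ->
  (forall e N, 0 < e -> exists2 n, (N <= n)%N & forall i, `|p 0 i - u n 0 i| < e) ->
  quasi F z p.
Proof.
move=> Fp zu pu; split=> // e e0; have [N HN] := invS_lt e0.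
have d0 : 0 < e / d.+1%:R by rewrite divr_gt0.
have [n Nn pn] := pu _ N d0.
have zun := delta_equiv_le (ltW (HN _ Nn)) (zu n).
apply: (delta_equiv_trans zun); apply: delta_equiv_step => //.
  by case: (delta_equiv_mem zun).
rewrite eucl_dist_sym; apply: le_trans (eucl_le (ltW d0) (fun i => ltW (pn i))) _.
by rewrite mulrCA ger_pMr // ler_pdivrMr // mul1r ler_nat.
Qed.

(** If separated parts [A] and [B] made up the set, compactness would put them at a positive
    distance; ever finer chains from [A] to [B] would leave points in between, clustering at a point
    of neither part. *)
Lemma quasi_connected F z : compact F -> F z -> connected (quasi F z).
Proof.
move=> cF Fz; apply: contrapT => /connectedPn[E [E0 KE sepE]].
have Kz : quasi F z z by split=> // e _; exact: delta_equiv_refl.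
have [A [B [Az [q Bq] KAB sepAB]]] : exists A B, [/\ A z, B !=set0,
    quasi F z = A `|` B & separated A B].
  move: (Kz); rewrite KE => -[] Ez.
    by exists (E false), (E true).
  by exists (E true), (E false); rewrite setUC separatedC.
have KA x : A x -> quasi F z x by rewrite KAB; left.
have KB x : B x -> quasi F z x by rewrite KAB; right.
(* Pairs closer and closer together would cluster at a point in the closures of both parts. *)
have [e e0 eAB] : exists2 e, 0 < e &
    forall a b, A a -> B b -> ~ forall i, `|a 0 i - b 0 i| < e.
  apply: contrapT => ne.
  have /choice[u Hu] n : exists ab : 'rV[R]_d * 'rV[R]_d, [/\ A ab.1, B ab.2 &
      forall i, `|ab.1 0 i - ab.2 0 i| < n.+1%:R^-1].
    apply: contrapT => nab; apply: ne; exists n.+1%:R^-1; first by rewrite invr_gt0.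
    by move=> a b Aa Bb ab; apply: nab; exists (a, b).
  have Ku n : quasi F z (u n).1 by apply: KA; case: (Hu n).
  have [p Fp pu] := compact_seq_cluster cF (fun n => (Ku n).1).
  have Kp : quasi F z p.
    by apply: quasi_cluster pu => // n; case: (Ku n) => _; apply; rewrite invr_gt0.
  have clA : closure A p.
    move=> V /nbhs_ballP[r r0 rV]; have [n _ pn] := pu r 0%N r0.
    exists (u n).1; split; first by case: (Hu n).
    by apply: rV; split=> // i j; rewrite (ord1 i); exact: pn.
  have clB : closure B p.
    move=> V /nbhs_ballP[r r0 rV]; have r20 : 0 < r / 2 by rewrite divr_gt0.
    have [N HN] := invS_lt r20; have [n Nn pn] := pu _ N r20.
    have [_ Bn un] := Hu n; exists (u n).2; split => //.
    apply: rV; split=> // i j; rewrite (ord1 i) /ball /=.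
    apply: le_lt_trans (ler_distD ((u n).1 0 j) _ _) _.
    by apply: lt_trans (ltrD (pn j) (un j)) _; rewrite [ltRHS]splitr ltrD2l; exact: HN.
  have [AB1 AB2] := sepAB.
  move: Kp; rewrite KAB => -[Ap|Bp].
    by have : (A `&` closure B) p; [split|rewrite AB2].
  by have : (closure A `&` B) p; [split|rewrite AB1].
have e30 : 0 < e / 3 by rewrite divr_gt0.
pose P x := exists2 a, A a & forall i, `|a 0 i - x 0 i| < e / 3.
(* [w n] is where a chain from [z] to [q] leaves the [e / 3]-neighbourhood [P] of [A]. *)
have /choice[w Hw] n : exists w, [/\ delta_equiv dist F n.+1%:R^-1 z w, ~ P w &
    exists2 a, A a & forall i, `|a 0 i - w 0 i| < e / 3 + n.+1%:R^-1].
  apply: contrapT => nw.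
  have zq : delta_equiv dist F n.+1%:R^-1 z q by case: (KB q Bq) => _; apply; rewrite invr_gt0.
  have [] : P q /\ delta_equiv dist F n.+1%:R^-1 z q.
    apply: (@delta_equiv_closed _ _ _ _ _
      (fun x => P x /\ delta_equiv dist F n.+1%:R^-1 z x) _ _ _ _ zq)
      => [x y [[a Aa ax] zx] Fy xy|]; last first.
      split; last exact: delta_equiv_refl.
      by exists z => // i; rewrite subrr normr0.
    have zy : delta_equiv dist F n.+1%:R^-1 z y.
      apply: (delta_equiv_trans zx); apply: delta_equiv_step => //.
      by case: (delta_equiv_mem zx).
    split=> //; apply: contrapT => nPy; apply: nw; exists y; split=> //.
    exists a => // i; rewrite -(subrK (x 0 i) (a 0 i)) -addrA.
    apply: le_lt_trans (ler_normD _ _) _; apply: ltr_leD => //.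
    exact: le_trans (coord_le_eucl _ _ _) xy.
  case=> a Aa aq _; apply: (eAB _ _ Aa Bq) => i.
  by apply: lt_trans (aq i) _; lra.
have Fw n : F (w n) by have [zw _ _] := Hw n; case: (delta_equiv_mem zw).
have [p Fp pw] := compact_seq_cluster cF Fw.
have : quasi F z p by apply: quasi_cluster pw => // n; case: (Hw n).
have [N HN] := invS_lt e30; have [n Nn pn] := pw _ N e30.
have [_ nP [a Aa aw]] := Hw n.
(* If [p] were in [A], then [w n] would lie in [P]; if in [B], then [p] would be within [e] of
   [A]. *)
rewrite KAB => -[Ap|Bp]; first by apply: nP; exists p.
apply: (eAB _ _ Aa Bp) => i.
apply: le_lt_trans (ler_distD (w n 0 i) _ _) _.
have wp : `|w n 0 i - p 0 i| < e / 3 by rewrite distrC; exact: pn.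
by apply: lt_trans (ltrD (aw i) wp) _; move: (HN _ Nn); move: (n.+1%:R^-1) => c; lra.
Qed.

(** Points far from [z] reached by ever finer chains would cluster at another point of the
    quasi-component, which is connected and hence inside the component. *)
Lemma trivial_component_small F z e : compact F -> F z ->
  connected_component F z = [set z] -> 0 < e ->
  exists2 r, 0 < r & forall y i, delta_equiv dist F r z y -> `|z 0 i - y 0 i| <= e.
Proof.
move=> cF Fz Cz e0; apply: contrapT => nr.
have /choice[w Hw] n : exists w, delta_equiv dist F n.+1%:R^-1 z w /\
    exists i, e < `|z 0 i - w 0 i|.
  apply: contrapT => nw; apply: nr; exists n.+1%:R^-1; first by rewrite invr_gt0.
  move=> y i zy; rewrite leNgt; apply/negP => ey; apply: nw.
  by exists y; split=> //; exists i.
have Fw n : F (w n) by have [zw _] := Hw n; case: (delta_equiv_mem zw).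
have [p Fp pw] := compact_seq_cluster cF Fw.
have Kp : quasi F z p by apply: quasi_cluster pw => // n; case: (Hw n).
have : connected_component F z p.
  apply: connected_component_max Kp; last exact: quasi_connected.
    by split=> // r _; exact: delta_equiv_refl.
  by move=> y [].
rewrite Cz => /= pz; have [n _ pn] := pw e 0%N e0.
by have [_ [i]] := Hw n; rewrite -pz ltNge (ltW (pn i)).
Qed.


(** The gap [r] separates [A] from the rest of [F], and a connected set cannot meet both. *)
Lemma isolated_component F (A : set 'rV[R]_d) z r : 0 < r -> A `<=` F ->
  (forall x y, A x -> F y -> (forall i, `|x 0 i - y 0 i| < r) -> A y) ->
  A z -> connected_component F z `<=` A.
Proof.
move=> r0 AF iso Az.
have sep : separated A (F `\` A).
  split; rewrite -subset0 => p [].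
    move=> clA [Fp nAp]; have [a [Aa [_ pa]]] := clA _ (nbhsx_ballx p r r0).
    by apply: nAp; apply: iso Aa Fp _ => i; rewrite distrC; exact: pa.
  move=> Ap clB; have [b [[Fb nAb] [_ pb]]] := clB _ (nbhsx_ballx p r r0).
  by apply: nAb; apply: iso Ap Fb _ => i; exact: pb.
have Fz := AF _ Az.
have [] := connected_subset sep _ (@component_connected _ F z) => //.
  move=> y /connected_component_sub Fy.
  by have [Ay|nAy] := pselect (A y); [left|right].
by move=> /(_ z (connected_component_refl Fz)) [].
Qed.

(** A discrete intermediate value theorem: steps of length at most [e] cannot jump over a slab of
    width [e]. *)
Lemma delta_equiv_crossing F e x y i (L : R) : delta_equiv dist F e x y ->
  x 0 i < L -> L <= y 0 i ->
  exists2 p, delta_equiv dist F e x p & L <= p 0 i < L + e.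
Proof.
move=> xy xL Ly; apply: contrapT => np.
have Fx : F x by case: (delta_equiv_mem xy).
have [] : y 0 i < L /\ delta_equiv dist F e x y; last by rewrite ltNge Ly.
apply: (@delta_equiv_closed _ _ _ _ _
  (fun p => p 0 i < L /\ delta_equiv dist F e x p) _ _ _ _ xy); last first.
  by split=> //; exact: delta_equiv_refl.
move=> p q [pL xp] Fq pq.
have xq : delta_equiv dist F e x q.
  apply: (delta_equiv_trans xp); apply: delta_equiv_step => //.
  by case: (delta_equiv_mem xp).
split=> //; rewrite ltNge; apply/negP => Lq; apply: np; exists q => //.
rewrite Lq /=; have := le_trans (coord_le_eucl p q i) pq.
by rewrite ler_norml => /andP[h _]; lra.
Qed.

End Euclid.

(** * Box dimension from power bounds on covering numbers *)

Section BoxDimension.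
Variables (R : realType) (T : choiceType) (rho : T -> T -> R) (X : set T).
Local Notation cov := (covering_number rho X).

Lemma near_right01 : \forall x \near (0 : R)^'+, 0 < x < 1.
Proof.
near=> x; apply/andP; split; near: x; first exact: nbhs_right_gt.
exact: nbhs_right_lt.
Unshelve. all: by end_near. Qed.

(** The quotient defining the box dimension, evaluated on an exact power with factor [c] and
    exponent [- a]. *)
Lemma log_ratio_cvg (c a : R) :
  ((ln c + a * - ln x) * (- ln x)^-1)%:E @[x --> 0^'+] --> a%:E.
Proof.
apply: cvg_EFin; first exact: nearW.
have lnV0 : (- ln x)^-1 @[x --> (0 : R)^'+] --> (0 : R).
  apply/(gtr0_cvgV0 (f := fun x : R => - ln x)).
    by apply: filterS near_right01 => x /ln_lt0; rewrite oppr_gt0.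
  by apply/cvgNry; exact: lnNy.
have : ln c * (- ln x)^-1 + a @[x --> (0 : R)^'+] --> ln c * 0 + a.
  by apply: cvgD; [apply: cvgMr|exact: cvg_cst].
rewrite mulr0 add0r; apply: cvg_trans; apply: near_eq_cvg.
apply: filterS near_right01 => x /ln_lt0 x0 /=.
by rewrite mulrDl mulfK // oppr_eq0 lt_eqF.
Qed.

Lemma lne_power (c a x : R) : 0 < c -> 0 < x ->
  lne (c * x `^ (- a))%:E = (ln c + a * - ln x)%:E.
Proof.
move=> c0 x0; have p0 := powR_gt0 (- a) x0.
by rewrite lne_EFin ?mulr_gt0 // lnM ?posrE // ln_powR mulNr mulrN.
Qed.

Lemma lee_log_ratio (a c x : R) (v : \bar R) : 0 < c -> 0 < x < 1 ->
  ((c * x `^ (- a))%:E <= v)%E ->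
  (((ln c + a * - ln x) * (- ln x)^-1)%:E <= lne v * ((- ln x)^-1)%:E)%E.
Proof.
move=> c0 x01 cv; have /andP[x0 _] := x01; have p0 := powR_gt0 (- a) x0.
have v0 : (0 <= v)%E by apply: le_trans cv; rewrite lee_fin mulr_ge0 ?ltW.
rewrite EFinM -lne_power //; apply: lee_wpmul2r.
  by rewrite lee_fin invr_ge0 oppr_ge0 ltW // ln_lt0.
by rewrite lee_lne // in_itv /= ?leey ?andbT // lee_fin mulr_ge0 ?ltW.
Qed.

Lemma gee_log_ratio (a C x : R) (v : \bar R) : 0 < C -> 0 < x < 1 ->
  (0 <= v)%E -> (v <= (C * x `^ (- a))%:E)%E ->
  (lne v * ((- ln x)^-1)%:E <= ((ln C + a * - ln x) * (- ln x)^-1)%:E)%E.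
Proof.
move=> C0 x01 v0 vC; have /andP[x0 _] := x01; have p0 := powR_gt0 (- a) x0.
rewrite EFinM -lne_power //; apply: lee_wpmul2r.
  by rewrite lee_fin invr_ge0 oppr_ge0 ltW // ln_lt0.
by rewrite lee_lne // in_itv /= ?leey ?andbT // lee_fin mulr_ge0 ?ltW.
Qed.

Lemma box_dim_of_bounds (a c C : R) : 0 < c -> 0 < C ->
  (forall x, 0 < x < 1 -> ((c * x `^ (- a))%:E <= cov x)%E /\
     (cov x <= (C * x `^ (- a))%:E)%E) ->
  has_box_dim rho X a.
Proof.
move=> c0 C0 bounds.
apply: (squeeze_cvge _ (@log_ratio_cvg c a) (@log_ratio_cvg C a)).
apply: filterS near_right01 => x x01; have [lo hi] := bounds x x01.
rewrite (lee_log_ratio c0 x01 lo) /=; apply: gee_log_ratio => //.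
apply: le_trans lo; rewrite lee_fin mulr_ge0 ?(ltW c0) //.
exact: powR_ge0.
Qed.

Lemma box_dim_ge (a b c : R) : 0 < c ->
  (forall x, 0 < x < 1 -> ((c * x `^ (- a))%:E <= cov x)%E) ->
  has_box_dim rho X b -> a <= b.
Proof.
move=> c0 bound bd; rewrite -lee_fin.
apply: (lee_cvg_to (@log_ratio_cvg c a) bd).
by apply: filterS near_right01 => x x01; exact: lee_log_ratio (bound x x01).
Qed.

Lemma covering_number_ge x (r : R) :
  (forall n, Defs.covered_by rho X x n -> r <= n%:R) -> (r%:E <= cov x)%E.
Proof.
move=> H; apply/ereal_infP => _ [n Hn <-]; rewrite lee_fin; exact: H.
Qed.

Lemma covering_number_le x n : Defs.covered_by rho X x n -> (cov x <= n%:R%:E)%E.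
Proof. by move=> Hn; apply: ereal_inf_lbound; exists n. Qed.

End BoxDimension.

(** * Words, digits and integer addresses of cells *)

Section Words.
Variables (d m : nat).
Implicit Types (s : pred 'I_d) (a : 'rV['I_m]_d) (w v : seq 'rV['I_m]_d).

(* Reversing the axes selected by [s] is the symmetry that moves the faces
   [x_i = 1] with [s i] onto the faces [x_i = 0]. *)
Definition digit s a (i : 'I_d) : nat := if s i then (m.-1 - a 0%R i)%N else a 0%R i.

(** A base-[m] number, most significant digit first: the position of the cell of [w] along axis [i],
    in units of its side. *)
Fixpoint address s w (i : 'I_d) : nat :=
  if w is a :: w' then (digit s a i * m ^ size w' + address s w' i)%N else 0%N.

Lemma digit_lt s a i : (digit s a i < m)%N.
Proof. by rewrite /digit; have := ltn_ord (a 0 i); case: ifP => _; lia. Qed.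

Lemma address_lt s w i : (address s w i < m ^ size w)%N.
Proof.
elim: w => //= a w IH; rewrite expnS.
have := digit_lt s a i; move: (digit _ _ _) => x xm; nia.
Qed.

Lemma divmod_inj (M a b a' b' : nat) : (b < M)%N -> (b' < M)%N ->
  (a * M + b = a' * M + b')%N -> a = a' /\ b = b'.
Proof.
move=> bM b'M e; have M0 : (0 < M)%N by apply: leq_ltn_trans bM.
split; last by move: (congr1 (modn^~ M) e); rewrite !modnMDl !modn_small.
by move: (congr1 (divn^~ M) e); rewrite !divnMDl // !divn_small // !addn0.
Qed.

Lemma digit_inj s a a' : digit s a =1 digit s a' -> a = a'.
Proof.
move=> e; apply/rowP => i; apply/val_inj; have := e i; rewrite /digit /=.
by have := ltn_ord (a 0 i); have := ltn_ord (a' 0 i); case: ifP => _; lia.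
Qed.

Lemma address_inj s w v : size w = size v -> address s w =1 address s v -> w = v.
Proof.
elim: w v => [|a w IH] [|b v] //= [sz] e.
have /all_and2[e1 e2] i := divmod_inj (address_lt s w i)
  (eq_ind_r (fun k => _ < m ^ k)%N (address_lt s v i) sz)
  (etrans (e i) (congr1 (fun k => _ * m ^ k + _)%N (esym sz))).
by rewrite (digit_inj e1) (IH _ sz e2).
Qed.

End Words.

(** * Similarities attached to words *)

Section Maps.
Variables (R : realType) (d m : nat).
Hypothesis m_gt1 : (1 < m)%N.
Implicit Types (s : pred 'I_d) (w : seq 'rV['I_m]_d) (x : 'rV[R]_d).

Definition word_map w x : 'rV[R]_d := foldr (@cube_map R d m) x w.

Definition coord s x (i : 'I_d) : R := if s i then 1 - x 0 i else x 0 i.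

Lemma word_map_cat w v x : word_map (w ++ v) x = word_map w (word_map v x).
Proof. exact: foldr_cat. Qed.

Lemma natm_gt0 n : 0 < m%:R ^+ n :> R.
Proof. by rewrite exprn_gt0 // ltr0n; lia. Qed.

(** Up to scaling, [word_map w] is translation by the address. Reversing an axis complements all
    digits, so the formula survives in reversed coordinates. *)
Lemma coord_word_map s w x i :
  m%:R ^+ size w * coord s (word_map w x) i = coord s x i + (address s w i)%:R.
Proof.
elim: w => [|a w IH] /=; first by rewrite mul1r addr0.
rewrite natrD natrM natrX addrCA -IH.
rewrite /coord /digit in IH *; rewrite !mxE.
have m0 : m%:R != 0 :> R by rewrite pnatr_eq0; lia.
case: ifP => _; last by rewrite exprS; field.
rewrite natrB; last by have := ltn_ord (a 0 i); lia.
by rewrite -subn1 natrB; [rewrite exprS; field | lia].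
Qed.

Lemma coord_sub s x y i : `|coord s x i - coord s y i| = `|x 0 i - y 0 i|.
Proof.
rewrite /coord; case: ifP => // _.
by rewrite distrC; congr (`| _ |); ring.
Qed.

Lemma word_map_dist w x y i :
  m%:R ^+ size w * `|word_map w x 0 i - word_map w y 0 i| = `|x 0 i - y 0 i|.
Proof.
have e z := coord_word_map xpred0 w z i.
rewrite -[X in X * _](ger0_norm (ltW (natm_gt0 _))) -normrM mulrBr.
by move: (e x) (e y); rewrite /coord /= => -> ->; congr (`| _ |); ring.
Qed.

End Maps.

(** * Cells of the fractal cube, and its place in the unit cube *)

Section FractalCube.
Variables (R : realType) (d m : nat).
Hypothesis m_gt1 : (1 < m)%N.
Variables (D : {set 'rV['I_m]_d}) (F : set 'rV[R]_d).
Hypothesis hF : is_fractal_cube D F.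
Implicit Types (s : pred 'I_d) (w : seq 'rV['I_m]_d) (x y : 'rV[R]_d).
Local Notation dist := (@eucl_dist R d).

Lemma natm_exp_gt (K e : R) : 0 < e -> exists n, K < m%:R ^+ n * e.
Proof.
move=> e0; exists (Num.truncn (K / e)).+1; rewrite -ltr_pdivrMr //.
apply: (lt_trans (truncnS_gt _)).
by rewrite -natrX ltr_nat ltn_expl.
Qed.

Definition dword n w := (size w == n) && all [in D] w.

Lemma dword_cat n k w v : dword n w -> dword k v -> dword (n + k)%N (w ++ v).
Proof.
by move=> /andP[/eqP sw aw] /andP[/eqP sv av]; rewrite /dword size_cat sw sv eqxx all_cat aw.
Qed.

Lemma word_map_cube n w x : dword n w -> F x -> F (word_map w x).
Proof.
case/andP=> _; elim: w => [|a w IH] //= /andP[aD wD] Fx.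
by case: hF => _ _ ->; exists a => //; exists (word_map w x) => //; apply: IH.
Qed.

Lemma cube_word n x : F x -> exists w y, [/\ dword n w, F y & x = word_map w y].
Proof.
elim: n x => [|n IH] x Fx; first by exists [::], x.
have := Fx; case: hF => _ _ {1}-> [a aD [y Fy <-]].
have [w [z [/andP[/eqP sw aw] Fz ->]]] := IH _ Fy.
by exists (a :: w), z; split => //; rewrite /dword /= sw eqxx aw andbT.
Qed.

(** Zooming into the cell of [x] multiplies a negative coordinate by [m ^ n] and subtracts a
    nonnegative address, which contradicts the boundedness of [F]. *)
Lemma coord_cube_ge0 s x i : F x -> 0 <= coord s x i.
Proof.
have [M HM] : exists M, forall y, F y -> `|y 0 i| <= M.
  have : compact ((fun y : 'rV[R]_d => y 0 i) @` F).
    apply: continuous_compact; last by case: hF.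
    exact/continuous_subspaceT/coord_continuous.
  case/compact_bounded => M [_ HM]; exists (M + 1) => y Fy.
  by apply: (HM (M + 1)); [rewrite ltrDl|exists y].
move=> Fx; rewrite leNgt; apply/negP => x0.
have [n Hn] := @natm_exp_gt (M + 1) (- coord s x i) (ltac:(by rewrite oppr_gt0)).
have [w [y [/andP[/eqP sw _] Fy xE]]] := cube_word n Fx.
have := coord_word_map m_gt1 s w y i; rewrite -xE sw => e.
have := HM _ Fy; rewrite ler_norml => /andP[y1 y2].
have : - (M + 1) <= coord s y i by rewrite /coord; case: ifP => _; lra.
have := ler0n R (address s w i); lra.
Qed.

(** This is the lower bound with every reversal flipped. *)
Lemma coord_cube_le1 s x i : F x -> coord s x i <= 1.
Proof.
move/(coord_cube_ge0 (predC s) i); rewrite /coord /=.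
by case: (s i) => /=; lra.
Qed.

Lemma cube_dist_le1 x y i : F x -> F y -> `|x 0 i - y 0 i| <= 1.
Proof.
move=> Fx Fy; have := coord_cube_ge0 xpred0 i Fx; have := coord_cube_ge0 xpred0 i Fy.
have := coord_cube_le1 xpred0 i Fx; have := coord_cube_le1 xpred0 i Fy.
rewrite /coord /= ler_norml; lra.
Qed.

(** * Pockets: isolated pieces that avoid one of each two opposite faces *)

(* [I] lists the faces (the faces [x_i = 0], after the reversal [s]) that the
   piece [E] is allowed to approach within [eta]. *)
Definition pocket s (I : {set 'I_d}) (eta : R) (E : set 'rV[R]_d) :=
  [/\ 0 < eta, E !=set0, E `<=` F,
      forall x y, E x -> F y -> (forall i, `|x 0 i - y 0 i| < eta) -> E y &
      forall x i, E x -> coord s x i <= 1 - eta /\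
                         (i \notin I -> eta <= coord s x i)].

(* The cell of [v] is obtained from that of [w] by moving one step towards the
   faces [x_i = 0] along some of the axes in [I]. *)
Definition below s (I : {set 'I_d}) (w v : seq 'rV['I_m]_d) :=
  forall i, (address s v i <= address s w i <= address s v i + (i \in I))%N.

Definition lonely s (I : {set 'I_d}) n (w : seq 'rV['I_m]_d) :=
  forall v, dword n v -> below s I w v -> v = w.

(* A cell meeting a copy of [E] can only lie on the side of the faces in [I]. *)
Lemma pocket_below s I eta E n w v x y :
  pocket s I eta E -> dword n w -> dword n v -> E x -> F y ->
  (forall i, m%:R ^+ n * `|word_map w x 0 i - word_map v y 0 i| < eta) ->
  below s I w v.
Proof.
move=> [eta0 _ EF _ marg] /andP[/eqP sw _] /andP[/eqP sv _] Ex Fy near i.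
have := near i; rewrite -(coord_sub s) -[X in X * _](ger0_norm (ltW (natm_gt0 R m_gt1 _))).
rewrite -normrM mulrBr -{1}sw -sv !coord_word_map // ltr_norml => /andP[h1 h2].
have x0 := coord_cube_ge0 s i (EF _ Ex); have y0 := coord_cube_ge0 s i Fy.
have y1 := coord_cube_le1 s i Fy; have [x1 xI] := marg _ i Ex.
(* The upper margin [1 - eta] of [x] excludes a step up; two steps down leave a gap of at least 1,
   and off [I] the lower margin excludes even one. *)
apply/andP; split; rewrite leqNgt; apply/negP.
  by rewrite -(ler_nat R) -natr1; lra.
case: (boolP (i \in I)) xI => _ xI; rewrite ?addn1 ?addn0 => lt.
  by have : (address s v i)%:R + 2 <= (address s w i)%:R :> R;
    [rewrite -natrD ler_nat; lia|lra].
have := xI isT.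
by have : (address s v i)%:R + 1 <= (address s w i)%:R :> R;
  [rewrite natr1 ler_nat; lia|lra].
Qed.

(** A cell close to the copy of [E] is below [w], hence is [w] itself, where isolation is inherited
    from [E]. A nonzero address keeps the copy one cell away from the face, which is thus dropped
    from [I]. *)
Lemma lonely_pocket s I eta E n w : pocket s I eta E -> dword n w ->
  lonely s I n w ->
  pocket s [set i in I | address s w i == 0%N] (eta / m%:R ^+ n) (word_map w @` E).
Proof.
move=> P Dw lw; have [eta0 [x0 Ex0] EF iso marg] := P.
have M0 := natm_gt0 R m_gt1 n.
have sw : size w = n by case/andP: Dw => /eqP.
split.
- exact: divr_gt0.
- by exists (word_map w x0); exists x0.
- by move=> _ [x Ex <-]; apply: word_map_cube (EF _ Ex); exact: Dw.
- move=> _ y [x Ex <-] /(cube_word n)[v [y' [Dv Fy' ->]]] near.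
  have near' i : m%:R ^+ n * `|word_map w x 0 i - word_map v y' 0 i| < eta.
    by rewrite mulrC -ltr_pdivlMr.
  have vw := lw _ Dv (pocket_below P Dw Dv Ex Fy' near').
  subst v; exists y' => //; apply: iso Ex Fy' _ => i.
  by have := near' i; rewrite -{1}sw word_map_dist.
move=> _ i [x Ex <-].
have := coord_word_map m_gt1 s w x i; rewrite sw => e.
have [x1 xI] := marg _ i Ex; have x0' := coord_cube_ge0 s i (EF _ Ex).
have eta1 : eta <= 1 by lra.
have lt : (address s w i)%:R + 1 <= m%:R ^+ n :> R.
  by rewrite -natrX natr1 ler_nat -sw address_lt.
have cE : coord s (word_map w x) i = (coord s x i + (address s w i)%:R) / m%:R ^+ n.
  by rewrite -e mulrAC mulfV ?mul1r // gt_eqF.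
rewrite cE; split.
  by rewrite ler_pdivrMr // mulrBl divfK ?gt_eqF //; lra.
rewrite ler_pM2r ?invr_gt0 // inE negb_and => /orP[/xI|wi].
  by have := ler0n R (address s w i); lra.
have : 1 <= (address s w i)%:R :> R by rewrite ler1n lt0n.
lra.
Qed.

(** * Pockets approaching the fewest faces *)

Definition minimal_pocket s I eta E := pocket s I eta E /\
  forall s' I' eta' E', pocket s' I' eta' E' -> (#|I| <= #|I'|)%N.

Lemma minimal_pocket_exists s I eta E : pocket s I eta E ->
  exists s' I' eta' E', minimal_pocket s' I' eta' E'.
Proof.
move=> P; pose Q k := `[< exists s I eta E, pocket s I eta E /\ #|I| = k >].
have exQ : exists k, Q k by exists #|I|; apply/asboolP; exists s, I, eta, E.
case: (ex_minnP exQ) => k /asboolP[s' [I' [eta' [E' [P' <-]]]]] kmin.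
exists s', I', eta', E'; split=> // s2 I2 eta2 E2 P2; apply: kmin.
by apply/asboolP; exists s2, I2, eta2, E2.
Qed.

(** Otherwise [w] is lonely, and the copy of [E] in its cell is a pocket that no longer approaches
    face [i]. *)
Lemma minimal_pocket_below s I eta E n w i : minimal_pocket s I eta E ->
  dword n w -> i \in I -> address s w i != 0%N ->
  exists v, [/\ dword n v, below s I w v & v != w].
Proof.
move=> [P Pmin] Dw iI wi; apply: contrapT => none.
have lw : lonely s I n w.
  by move=> v Dv vw; apply/eqP; apply: contrapT => /negP vNw; apply: none; exists v.
have := Pmin _ _ _ _ (lonely_pocket P Dw lw); rewrite leqNgt => /negP; apply.
apply: proper_card; apply/properP; split.
  by apply/fintype.subsetP => j; rewrite inE => /andP[].
by exists i => //; rewrite inE (negbTE wi) andbF.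
Qed.

(** Two touching cells span at most two sides, less than [eta], so membership in [E] passes from one
    to the other. *)
Lemma pocket_adjacent s I eta E n w v x y : pocket s I eta E ->
  2 < m%:R ^+ n * eta -> dword n w -> dword n v ->
  (forall i, address s w i <= (address s v i).+1)%N ->
  (forall i, address s v i <= (address s w i).+1)%N ->
  F x -> F y -> E (word_map w x) -> E (word_map v y).
Proof.
move=> [_ _ _ iso _] n2 Dw Dv wv vw Fx Fy Ewx.
apply: iso Ewx (word_map_cube Dv Fy) _ => i.
have M0 := natm_gt0 R m_gt1 n.
have /andP[/eqP sw _] := Dw; have /andP[/eqP sv _] := Dv.
rewrite -(ltr_pM2l M0); apply: le_lt_trans n2.
rewrite -(coord_sub s) -[X in X * _](ger0_norm (ltW M0)).
rewrite -normrM mulrBr -{1}sw -sv !coord_word_map // ler_norml.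
have := wv i; have := vw i; rewrite -!(ler_nat R) -!natr1.
have := coord_cube_ge0 s i Fx; have := coord_cube_le1 s i Fx.
have := coord_cube_ge0 s i Fy; have := coord_cube_le1 s i Fy.
by move=> *; apply/andP; split; lra.
Qed.

(** Iterated moves to a cell below strictly lower the sum of the addresses until the faces in [I]
    are reached; consecutive cells touch. *)
Lemma minimal_pocket_descend s I eta E n w : minimal_pocket s I eta E ->
  2 < m%:R ^+ n * eta -> dword n w ->
  exists b, [/\ dword n b, forall i, i \in I -> address s b i = 0%N,
    forall i, i \notin I -> address s b i = address s w i &
    forall x y, F x -> F y -> E (word_map w x) <-> E (word_map b y)].
Proof.
move=> mP n2; have [P _] := mP.
have [k] := ubnP (\sum_(i < d) address s w i)%N; elim: k w => // k IH w lek Dw.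
have [w0|] := boolP [forall i in I, address s w i == 0%N].
  exists w; split=> // [i iI|x y Fx Fy]; first exact/eqP/(forall_inP w0).
  by split; apply: (pocket_adjacent P n2).
rewrite negb_forall_in => /exists_inP[i iI wi].
have [v [Dv vw vNw]] := minimal_pocket_below mP Dw iI wi.
have {}lek : (\sum_(i < d) address s v i < k)%N.
  rewrite -ltnS; apply: leq_trans lek; rewrite ltnS.
  have [j jv] : exists j, (address s v j != address s w j).
    apply: contrapT => nj; case/negP: vNw; apply/eqP.
    have /andP[/eqP sw _] := Dw; have /andP[/eqP sv _] := Dv.
    apply: (@address_inj _ _ s); rewrite ?sw // => j.
    by apply/eqP; apply: contrapT => /negP ?; apply: nj; exists j.
  rewrite (bigD1 j) //= [X in (_ < X)%N](bigD1 j) //= -addSn.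
  apply: leq_add; first by rewrite ltn_neqAle jv; case/andP: (vw j).
  by apply: leq_sum => l _; case/andP: (vw l).
have [b [Db b0 bv Eb]] := IH v lek Dv; exists b; split=> // [l lI|x y Fx Fy].
  by rewrite bv //; have := vw l; rewrite (negbTE lI); lia.
rewrite -(Eb x y Fx Fy).
by split; apply: (pocket_adjacent P n2) => // l;
  have := vw l; case: (l \in I) => /=; lia.
Qed.

(** A nonzero digit [a] puts the cell of [a :: b] off face [i] although [b] lies on it. The cell
    below it has a tail [b'] that wraps around to an opposite face, yet [b'] descends to [b] and so
    belongs to [E]. *)
Lemma minimal_pocket_digit s I eta E a i : minimal_pocket s I eta E ->
  a \in D -> i \in I -> digit s a i = 0%N.
Proof.
move=> mP aD iI; apply/eqP; apply: contrapT => /negP ai.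
have [[eta0 [x0 Ex0] EF _ marg] _] := mP.
have [n n2] := natm_exp_gt 2 eta0.
have [w [x' [Dw Fx' x0E]]] := cube_word n (EF _ Ex0).
have [b [Db b0 bw Eb]] := minimal_pocket_descend mP n2 Dw.
have Dab : dword n.+1 (a :: b) by apply: (@dword_cat 1 n [:: a]); rewrite /dword /= ?aD.
have /andP[/eqP sb _] := Db.
have M0 : (0 < m ^ n)%N by rewrite expn_gt0; lia.
have abi : address s (a :: b) i != 0%N by rewrite /= sb b0 // addn0 muln_eq0 negb_or ai -lt0n.
have [[|a' b'] [Dv vab vNab]] := minimal_pocket_below mP Dab iI abi; first by case/andP: Dv.
have Db' : dword n b'.
  by case/andP: Dv; rewrite /dword /= eqSS => -> /andP[].
have /andP[/eqP sb' _] := Db'.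
(* Along an axis of [I] the address of [b] is 0, so a step down must borrow from the leading digit
   and leave [m ^ n - 1] in the tail. *)
have key j : address s b' j = address s b j /\ digit s a' j = digit s a j \/
    j \in I /\ ((address s b' j).+1 = m ^ n)%N.
  have := vab j; rewrite /= sb sb'.
  have := address_lt s b' j; rewrite sb'; have := address_lt s b j; rewrite sb.
  move=> lb lb' /andP[]; case: (boolP (j \in I)) => jI /=; last first.
    rewrite addn0 => h1 h2; left.
    have /(divmod_inj lb' lb)[-> ->//] : (digit s a' j * m ^ n + address s b' j =
      digit s a j * m ^ n + address s b j)%N by apply/eqP; rewrite eqn_leq h1 h2.
  rewrite (b0 _ jI) addn0 in lb *; rewrite leq_eqVlt => /orP[/eqP h _|h1 h2].
    left; have := divmod_inj lb' lb (etrans h (esym (addn0 _))).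
    by case.
  right; split=> //.
  have h : ((address s b' j).+1 = (digit s a j - digit s a' j) * m ^ n)%N.
    by rewrite mulnBl; clear -h1 h2; lia.
  move: h; case: (_ - _)%N => [|[|k]]; rewrite ?mul1n //.
  rewrite 2!mulSn; move: (k * _)%N => z; clear -lb' M0; lia.
(* Without any borrow the two words would coincide. *)
have [j [jI b'j]] : exists j, j \in I /\ ((address s b' j).+1 = m ^ n)%N.
  apply: contrapT => nj; case/negP: vNab; apply/eqP.
  have {}key j : address s b' j = address s b j /\ digit s a' j = digit s a j.
    by case: (key j) => // h; case: nj; exists j.
  congr (_ :: _); first by apply: (@digit_inj _ _ s) => j; case: (key j).
  by apply: (@address_inj _ _ s); rewrite ?sb // => j; case: (key j).
(* Off [I] the addresses of [b'] and [b] agree, so descending from [b'] ends at [b]. *)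
have [c [Dc c0 cb' Ec]] := minimal_pocket_descend mP n2 Db'.
have cb : c = b.
  have /andP[/eqP sc _] := Dc.
  apply: (@address_inj _ _ s) => [|l]; first by rewrite sb.
  have [lI|lI] := boolP (l \in I); first by rewrite c0 ?b0.
  by rewrite cb' //; case: (key l) => [[]//|[]]; rewrite (negbTE lI).
have Eb' : E (word_map b' x').
  apply/(Ec x' x' Fx' Fx'); rewrite cb; apply/(Eb x' x' Fx' Fx').
  by rewrite -x0E.
(* The cell of [b'] is the last one along [j], closer than [eta] to the face that [E] avoids. *)
have [b'1 _] := marg _ j Eb'.
have := coord_word_map m_gt1 s b' x' j; rewrite sb'.
have -> : (address s b' j)%:R = m%:R ^+ n - 1 :> R by rewrite -natrX -b'j -natr1 addrK.
have := coord_cube_ge0 s j Fx'.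
have := ler_wpM2l (ltW (natm_gt0 R m_gt1 n)) b'1; rewrite mulrBr mulr1; lra.
Qed.

(** * Islands, whose copies are isolated at every scale, and trivial points *)

Definition island s (I : {set 'I_d}) eta E := pocket s I eta E /\
  forall a i, a \in D -> i \in I -> digit s a i = 0%N.

Lemma island_exists s I eta E : pocket s I eta E ->
  exists s' I' eta' E', island s' I' eta' E'.
Proof.
case/minimal_pocket_exists=> s' [I' [eta' [E' mP]]]; exists s', I', eta', E'.
by split=> [|a i aD iI]; [case: mP|exact: minimal_pocket_digit mP aD iI].
Qed.

(** Along [I] all addresses vanish, and off [I] the relation [below] allows no change. *)
Lemma island_lonely s I eta E n w : island s I eta E -> dword n w -> lonely s I n w.
Proof.
move=> [_ d0] Dw v Dv vw.
have a0 k u i : dword k u -> i \in I -> address s u i = 0%N.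
  elim: u k => // a u IH [//|k] /andP[/eqP[su] /= /andP[aD uD]] iI.
  by rewrite d0 // (IH k) // /dword su eqxx.
have /andP[/eqP sw _] := Dw; have /andP[/eqP sv _] := Dv.
apply: (@address_inj _ _ s); rewrite ?sw // => i.
have [iI|iI] := boolP (i \in I); first by rewrite !(a0 n).
by have := vw i; rewrite (negbTE iI); lia.
Qed.

(** The piece is the [r]-class of [x]. Reversing the axes where it exceeds 3/4 keeps it off all
    faces [x_i = 1]; as [I] is full, nothing is asked at the faces [x_i = 0]. *)
Lemma component_pocket x r : F x -> 0 < r ->
  (forall i, (forall y, delta_equiv dist F r x y -> y 0 i <= 3 / 4) \/
     (forall y, delta_equiv dist F r x y -> 1 / 4 <= y 0 i)) ->
  exists s I eta E, pocket s I eta E.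
Proof.
move=> Fx r0 half; pose eta := Num.min (r / d.+1%:R) (1 / 4).
pose low i := forall y, delta_equiv dist F r x y -> y 0 i <= 3 / 4.
have eta4 : eta <= 1 / 4 by rewrite ge_min lexx orbT.
have etar : d%:R * eta <= r.
  apply: (@le_trans _ _ (d%:R * (r / d.+1%:R))).
    by apply: ler_wpM2l => //; rewrite ge_min lexx.
  by rewrite mulrCA ger_pMr // ler_pdivrMr // mul1r ler_nat.
have eta0 : 0 < eta by rewrite lt_min !divr_gt0.
exists (fun i => ~~ `[< low i >]), [set: 'I_d]%SET, eta,
  [set y | delta_equiv dist F r x y]; split=> //.
- by exists x; exact: delta_equiv_refl.
- by move=> y xy; case: (delta_equiv_mem xy).
- move=> y z xy Fz yz; apply: (delta_equiv_trans xy); apply: delta_equiv_step => //.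
    by case: (delta_equiv_mem xy).
  by apply: le_trans etar; apply: eucl_le => [|i]; apply/ltW.
move=> y i xy; rewrite finset.inE /=; split=> //.
rewrite /coord; case: asboolP => /= [/(_ y xy)|nl]; first by lra.
by case: (half i) => // /(_ y xy); lra.
Qed.

Lemma trivial_point_pocket : has_trivial_point F -> exists s I eta E, pocket s I eta E.
Proof.
case=> z Fz Cz; have [_ cF _] := hF.
have [r r0 small] := trivial_component_small cF Fz Cz (ltac:(lra) : 0 < 1 / 4 :> R).
apply: (component_pocket Fz r0) => i.
have [z2|z2] := leP (z 0 i) (1 / 2); [left|right] => y zy; have := small y i zy;
  rewrite ler_norml => /andP[]; lra.
Qed.

(** The trivial point is the fixed point of [word_map w] for a cell [w] inside [E]: the copies of
    [E] along the powers of [w] are isolated and shrink to it. *)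
Lemma island_trivial_point s I eta E : island s I eta E -> has_trivial_point F.
Proof.
move=> isl; have [P _] := isl; have [eta0 [x0 Ex0] EF iso _] := P.
(* The successor keeps [n] positive, so that [m ^ n - 1] is nonzero. *)
have [n0 n0eta] := natm_exp_gt 1 eta0; pose n := n0.+1.
have neta : 1 < m%:R ^+ n * eta.
  apply: lt_le_trans n0eta _; apply: ler_wpM2r; first exact: ltW.
  by rewrite ler_weXn2l // ler1n ltnW.
have M0 := natm_gt0 R m_gt1 n.
have M1 : 1 < m%:R ^+ n :> R by rewrite exprn_egt1 // ltr1n.
have [w [x [Dw Fx x0E]]] := cube_word n (EF _ Ex0).
have /andP[/eqP sw _] := Dw.
have wE y : F y -> E (word_map w y).
  move=> Fy; apply: iso Ex0 (word_map_cube Dw Fy) _ => i.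
  rewrite x0E -(ltr_pM2l M0) -{1}sw word_map_dist //.
  exact: le_lt_trans (cube_dist_le1 i Fx Fy) neta.
pose wk k := iter k (cat w) [::].
have Dwk k : dword (n * k)%N (wk k).
  by elim: k => [|k IH]; [rewrite muln0|rewrite mulnS; exact: dword_cat].
(* This solves the fixed point equation [m ^ n * z = z + address]. *)
pose z : 'rV[R]_d := \row_i ((address xpred0 w i)%:R / (m%:R ^+ n - 1)).
have zE i : z 0 i * (m%:R ^+ n - 1) = (address xpred0 w i)%:R.
  by rewrite mxE divfK // subr_eq0 gt_eqF.
have wz : word_map w z = z.
  apply/rowP => i; apply: (mulfI (lt0r_neq0 M0)).
  have := coord_word_map m_gt1 xpred0 w z i; rewrite sw /coord /= => ->.
  by rewrite -zE; ring.
have wkS k y : word_map (wk k.+1) y = word_map w (word_map (wk k) y).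
  by rewrite -word_map_cat.
have wkz k : word_map (wk k) z = z.
  by elim: k => // k IH; rewrite wkS IH.
have z01 i : 0 <= z 0 i <= 1.
  rewrite mxE; apply/andP; split; first by rewrite divr_ge0 // subr_ge0 ltW.
  rewrite ler_pdivrMr ?subr_gt0 // mul1r lerBrDr natr1 -natrX ler_nat -sw.
  exact: address_lt.
have zF y i : F y -> `|y 0 i - z 0 i| <= 1.
  move=> Fy; have := coord_cube_ge0 xpred0 i Fy; have := coord_cube_le1 xpred0 i Fy.
  have /andP[] := z01 i.
  by rewrite /coord /= => *; rewrite ler_norml; apply/andP; split; lra.
have shrink k y i : F y -> m%:R ^+ (n * k) * `|word_map (wk k) y 0 i - z 0 i| <= 1.
  move=> Fy; rewrite -{1}(wkz k); have /andP[/eqP <- _] := Dwk k.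
  by rewrite word_map_dist //; exact: zF.
have close0 y i : (forall k, m%:R ^+ (n * k) * `|y 0 i - z 0 i| <= 1) -> y 0 i = z 0 i.
  move=> small; apply/eqP; rewrite -subr_eq0 -normr_le0 leNgt; apply/negP => pos.
  have [k Hk] := natm_exp_gt 1 pos; have := small k; apply/negP; rewrite -ltNge.
  apply: lt_le_trans Hk _; apply: ler_wpM2r => //.
  by rewrite ler_weXn2l ?ler1n ?leq_pmull // ltnW.
(* The images of [x] under the powers of [w] stay in the compact set [F] and converge to [z]. *)
have Fz : F z.
  have [_ cF _] := hF.
  have [p Fp pz] := compact_seq_cluster cF (fun k => word_map_cube (Dwk k) Fx).
  suff -> : z = p by [].
  apply/rowP => i; apply/eqP; rewrite -subr_eq0 -normr_le0; apply/ler_addgt0Pl => e e0.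
  rewrite addr0; have e20 : 0 < e / 2 by rewrite divr_gt0.
  have [k Hk] := natm_exp_gt 1 e20.
  have [l kl pl] := pz _ k e20.
  apply: le_trans (ler_distD (word_map (wk l) x 0 i) _ _) _.
  rewrite [leRHS]splitr; apply: lerD; last by rewrite distrC ltW.
  rewrite distrC -(ler_pM2l (natm_gt0 R m_gt1 (n * l))).
  apply: le_trans (shrink l x i Fx) _; apply: (le_trans (ltW Hk)).
  apply: ler_wpM2r; first exact: ltW.
  rewrite ler_weXn2l ?ler1n ?(ltnW m_gt1) //.
  by apply: leq_trans kl _; rewrite leq_pmull.
have Ez : E z by rewrite -wz; exact: wE.
exists z => //; apply/seteqP; split=> [y Cy|_ ->]; last exact: connected_component_refl.
apply/rowP => i; apply: close0 => k.
(* The component of [z] cannot leave the isolated copy of [E] along the [k]-th power of [w]. *)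
have [eta'0 _ A_F isoA _] := lonely_pocket P (Dwk k) (island_lonely isl (Dwk k)).
have Az : (word_map (wk k) @` E) z by exists z.
have [y' Ey' <-] := isolated_component eta'0 A_F isoA Az Cy.
exact: shrink (EF _ Ey').
Qed.

(** * Counting cells and components *)

Lemma sub_words (w : seq 'rV['I_m]_d) : all [in D] w ->
  exists u : seq {a | a \in D}, map val u = w.
Proof.
elim: w => [|a w IH] /=; first by exists [::].
by case/andP=> aD /IH[u <-]; exists (exist _ a aD :: u).
Qed.

Lemma dword_tuple n (t : n.-tuple {a | a \in D}) : dword n (map val t).
Proof.
rewrite /dword size_map size_tuple eqxx /= all_map.
by apply/allP => a _ /=; exact: valP.
Qed.

Lemma card_words n : #|{: n.-tuple {a | a \in D}}| = (#|D| ^ n)%N.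
Proof. by rewrite card_tuple card_sig. Qed.

Lemma cube_covered n (e : R) : d%:R <= e * m%:R ^+ n ->
  Defs.covered_by dist F e (#|D| ^ n)%N.
Proof.
move=> de; rewrite -card_words.
exists (fun k => word_map (map val (enum_val k : n.-tuple {a | a \in D})) @` F); split.
  move=> k _ _ [x Fx <-] [y Fy <-].
  have /andP[/eqP sw _] := dword_tuple (enum_val k).
  have M0 := natm_gt0 R m_gt1 n.
  have Vm : 0 <= (m%:R ^+ n)^-1 :> R by rewrite invr_ge0 ltW.
  apply: (@le_trans _ _ (d%:R * (m%:R ^+ n)^-1)); last by rewrite ler_pdivrMr.
  apply: eucl_le => // i; rewrite -(ler_pM2l M0) -{1}sw word_map_dist // mulfV ?gt_eqF //.
  exact: cube_dist_le1.
move=> x /(cube_word n)[w [y [/andP[/eqP sw aw] Fy ->]]].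
have [u uw] := sub_words aw.
have su : size u == n by rewrite -sw -uw size_map.
by exists (enum_rank (Tuple su)) => //; exists y => //; rewrite enum_rankK /= uw.
Qed.

(** A chain with steps [e] cannot leave a copy of [E] isolated by [eta / m ^ n], so distinct words
    give points in distinct components. *)
Lemma island_components s I eta E n (e : R) : island s I eta E ->
  e * m%:R ^+ n < eta ->
  ((#|D| ^ n)%:R%:E <= num_components dist F e)%E.
Proof.
move=> isl en; have [P _] := isl; have [_ [x Ex] EF _ _] := P.
have Fx := EF _ Ex; have M0 := natm_gt0 R m_gt1 n.
rewrite -card_words.
pose wt (t : n.-tuple {a | a \in D}) := word_map (map val t) x.
apply: (@counting_ge _ _ _ (fun t => [set y | delta_equiv dist F e (wt t) y])).
  move=> t t' /(delta_component_eq (word_map_cube (dword_tuple t') Fx)) tt'.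
  have Dt := dword_tuple t; have Dt' := dword_tuple t'.
  have [_ _ _ isoT _] := lonely_pocket P Dt (island_lonely isl Dt).
  have [y Ey ty] : (word_map (map val t) @` E) (wt t').
    apply: delta_equiv_closed tt'; last by exists x.
    move=> p q Ap Fq pq; apply: isoT Ap Fq _ => i.
    rewrite ltr_pdivlMr //; apply: le_lt_trans en.
    by rewrite ler_pM2r //; exact: le_trans (coord_le_eucl _ _ _) pq.
  (* The point [wt t'] lies both in the copy of [E] along [t] and in the cell of [t'], at distance 0
     from itself. *)
  have bel : below s I (map val t) (map val t').
    apply: (pocket_below P Dt Dt' Ey Fx) => i.
    by rewrite ty subrr normr0 mulr0; case: P.
  apply/val_inj/(inj_map val_inj).
  by rewrite (island_lonely isl Dt Dt' bel).
by move=> t; exists (wt t) => //; exact: word_map_cube (dword_tuple t) Fx.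
Qed.

Lemma num_components_ge1 (e : R) : (1 <= num_components dist F e)%E.
Proof.
case: hF => [[x Fx] _ _].
have := @counting_ge R _ unit (fun=> [set y | delta_equiv dist F e x y])
  (delta_components dist F e).
by rewrite card_unit; apply=> [[] []//|_]; exists x.
Qed.

(** The least [n] fixes the scale up to a factor [m]; if [y] is small, then [n] is 0 and the upper
    bound may fail. *)
Lemma natm_scale (y : R) : exists n,
  y <= m%:R ^+ n /\ (n = 0%N \/ m%:R ^+ n <= m%:R * y).
Proof.
have exn : exists n, y <= m%:R ^+ n.
  by have [n /ltW] := @natm_exp_gt y 1 ltr01; rewrite mulr1; exists n.
case: (ex_minnP exn) => -[|n] yn nmin; first by exists 0%N; split=> //; left.
exists n.+1; split=> //; right; rewrite exprS ler_wpM2l // leNgt; apply/negP => yn'.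
by have := nmin n (ltW yn'); rewrite ltnn.
Qed.

(** * The power law at the similarity dimension *)

Hypothesis D_gt1 : (1 < #|D|)%N.

(** The similarity dimension of [F]; two digits or more make it positive, as the index of a power
    law must be. *)
Let s0 : R := ln #|D|%:R / ln m%:R.

Lemma sim_dim_gt0 : 0 < s0.
Proof. by rewrite divr_gt0 // ln_gt0 // ltr1n. Qed.

Lemma natm_powR_dim n : (m%:R ^+ n) `^ s0 = #|D|%:R ^+ n.
Proof.
have m0 : 0 < m%:R :> R by rewrite ltr0n ltnW.
have mD : m%:R `^ s0 = #|D|%:R.
  rewrite /powR gt_eqF // divfK ?lnK ?posrE ?ltr0n //; first exact: ltnW.
  by rewrite gt_eqF // ln_gt0 // ltr1n.
by rewrite -powR_mulrn ?ler0n // -powRrM mulrC powRrM mD powR_mulrn.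
Qed.

Lemma powR_scale (c e : R) : 0 < c -> 0 < e -> (c / e) `^ s0 = c `^ s0 * e `^ (- s0).
Proof.
move=> c0 e0; rewrite powRM ?invr_ge0 ?ltW //; congr (_ * _).
by rewrite -powR_inv1 ?ltW // -powRrM mulN1r.
Qed.

(** The [n] chosen for [d / e] gives cells of diameter at most [e], and their number is the power
    [s0] of [m ^ n]. *)
Lemma cube_covering_le (e : R) : (0 < d)%N -> 0 < e < 1 ->
  (covering_number dist F e <= ((m%:R * d%:R) `^ s0 * e `^ (- s0))%:E)%E.
Proof.
move=> d0 /andP[e0 e1]; have [n [ln un]] := natm_scale (d%:R / e).
have m0 : 0 < m%:R :> R by rewrite ltr0n ltnW.
have dR : 1 <= d%:R :> R by rewrite ler1n.
have dR0 : 0 < d%:R :> R by rewrite ltr0n.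
have {}un : m%:R ^+ n <= m%:R * (d%:R / e).
  case: un => // ->; rewrite expr0.
  have m1 : 1 <= m%:R :> R by rewrite ler1n ltnW.
  apply: (le_trans m1); rewrite ler_peMr ?ltW // lter_pdivlMr // mul1r; lra.
apply: le_trans (covering_number_le (n := (#|D| ^ n)%N) _) _.
  by apply: cube_covered; rewrite mulrC -ler_pdivrMr.
rewrite lee_fin natrX -natm_powR_dim -powR_scale ?mulr_gt0 // -mulrA.
apply: ge0_ler_powR => //; first exact/ltW/sim_dim_gt0.
  by rewrite nnegrE exprn_ge0 // ltW.
by rewrite nnegrE ltW // mulr_gt0 // divr_gt0.
Qed.

(** The factor [2 * m] absorbs the rounding of the scale and makes [e * m ^ n < eta] strict. *)
Lemma island_components_ge s I eta E (e : R) : island s I eta E -> 0 < e < 1 ->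
  (((eta / (2 * m%:R)) `^ s0 * e `^ (- s0))%:E <= num_components dist F e)%E.
Proof.
move=> isl /andP[e0 e1]; have [[eta0 _ _ _ _] _] := isl.
have m0 : 0 < m%:R :> R by rewrite ltr0n ltnW.
have c0 : 0 < eta / (2 * m%:R) by rewrite divr_gt0 // mulr_gt0.
have [n [ln un]] := natm_scale (eta / (2 * m%:R) / e).
apply: (@le_trans _ _ (#|D| ^ n)%:R%:E).
  rewrite lee_fin natrX -natm_powR_dim -powR_scale //.
  apply: ge0_ler_powR => //; first exact/ltW/sim_dim_gt0.
    by rewrite nnegrE ltW // divr_gt0.
  by rewrite nnegrE exprn_ge0 // ltW.
(* At level 0 only one component is claimed. *)
case: un => [->|un]; first exact: num_components_ge1.
apply: (island_components isl).
rewrite -ltr_pdivlMl //; apply: (le_lt_trans un).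
have -> : m%:R * (eta / (2 * m%:R) / e) = e^-1 * eta / 2.
  by field; rewrite !gt_eqF.
rewrite ltr_pdivrMr // ltr_pMr ?mulr_gt0 ?invr_gt0 //; lra.
Qed.

(** Components are at most as many as covering sets, so a lower bound for the former and an upper
    bound for the latter settle both the power law and the dimension. *)
Lemma island_maximal_power_law s I eta E : (0 < d)%N -> island s I eta E ->
  maximal_power_law dist F.
Proof.
move=> d0 isl; have [[eta0 _ _ _ _] _] := isl.
have m0 : 0 < m%:R :> R by rewrite ltr0n ltnW.
set c := (eta / (2 * m%:R)) `^ s0; set C := (m%:R * d%:R) `^ s0.
have c0 : 0 < c by apply: powR_gt0; rewrite divr_gt0 // mulr_gt0.
have C0 : 0 < C by apply: powR_gt0; rewrite mulr_gt0 // ltr0n.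
have lo e : 0 < e < 1 -> ((c * e `^ (- s0))%:E <= num_components dist F e)%E.
  exact: island_components_ge isl.
have hi e : 0 < e < 1 ->
    (covering_number dist F e <= (C * e `^ (- s0))%:E)%E.
  exact: cube_covering_le.
have mid e : (num_components dist F e <= covering_number dist F e)%E.
  by apply/ereal_infP => _ [n cov <-]; apply: num_components_le_cover => //;
    exact: eucl_dist_sym.
exists s0; split; first exact: sim_dim_gt0.
  have cV0 : 0 < c^-1 by rewrite invr_gt0.
  (* One constant above 1, [C] and [c^-1] serves both bounds. *)
  exists (1 + C + c^-1); first by lra.
  move=> e e01; have /andP[e0 _] := e01; have p0 := powR_gt0 (- s0) e0.
  split.
    apply: le_trans (lo e e01); rewrite lee_fin ler_pM2r //.
    by rewrite -[leRHS]invrK lef_pV2 ?posrE //; lra.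
  apply: le_trans (mid e) _; apply: le_trans (hi e e01) _.
  by rewrite lee_fin ler_pM2r //; lra.
apply: (box_dim_of_bounds c0 C0) => e e01; split; last exact: hi.
exact: le_trans (lo e e01) (mid e).
Qed.

(** * Covering numbers in the absence of pockets *)

(* Every [e]-component crosses the middle half of the cube along some axis, so
   it contains about [1 / (4 e)] points at mutual distances greater than [e]. *)
Lemma no_pocket_covering_ge (e : R) (n : nat) :
  ~ (exists s I eta E, pocket s I eta E) -> 0 < e < 1 ->
  Defs.covered_by dist F e n ->
  (num_components dist F e * ((4 * e)^-1)%:E <= n%:R%:E)%E.
Proof.
move=> noP /andP[e0 e1] cov; pose M := (Num.truncn (4 * e)^-1).+1.
have e40 : 0 < (4 * e)^-1 by rewrite invr_gt0 mulr_gt0.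
apply: (@le_trans _ _ (num_components dist F e * M%:R%:E)%E).
  apply: lee_wpmul2l; first exact: le_trans (num_components_ge1 e).
  by rewrite lee_fin ltW // truncnS_gt.
apply: (num_components_mul_le_cover (@eucl_dist_sym R d) cov) => x Fx.
have [i [p [q [xp xq pi qi]]]] : exists i p q,
    [/\ delta_equiv dist F e x p, delta_equiv dist F e x q,
        p 0 i < 1 / 4 & 3 / 4 < q 0 i].
  (* Without a crossing the class of [x] avoids one side along each axis, which yields a pocket. *)
  apply: contrapT => ncross; apply: noP; apply: (component_pocket Fx e0) => i.
  have [[q xq qi]|nq] := pselect (exists2 q,
      delta_equiv dist F e x q & 3 / 4 < q 0 i); [right|left] => y xy.
    by rewrite leNgt; apply/negP => yi; apply: ncross; exists i, y, q.
  by rewrite leNgt; apply/negP => yi; apply: nq; exists y.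
have pq : delta_equiv dist F e p q.
  by apply: delta_equiv_trans xq; apply: delta_equiv_sym => //; exact: eucl_dist_sym.
(* With spacing [2 * e], points in the slabs of width [e] above different levels are more than [e]
   apart; the last of the [M] levels is at most 3/4. *)
pose level (t : nat) : R := 1 / 4 + 2 * e * t%:R.
have /choice[r Hr] (t : 'I_M) : exists r,
    delta_equiv dist F e p r /\ level t <= r 0 i < level t + e.
  have t4 : t%:R <= (4 * e)^-1.
    apply: (@le_trans _ _ (Num.truncn (4 * e)^-1)%:R).
      by rewrite ler_nat -ltnS ltn_ord.
    by rewrite truncn_le // ltW.
  have lt : level t <= 3 / 4.
    have : 2 * e * t%:R <= 2 * e * (4 * e)^-1 by rewrite ler_pM2l // mulr_gt0.
    have -> : 2 * e * (4 * e)^-1 = 1 / 2 by field; rewrite gt_eqF.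
    by rewrite /level; lra.
  have pt : p 0 i < level t.
    by apply: (lt_le_trans pi); rewrite /level lerDl mulr_ge0 // mulr_ge0 // ltW.
  have [r pr rt] := delta_equiv_crossing pq pt (ltW (le_lt_trans lt qi)).
  by exists r.
have sep (t t' : 'I_M) : (t < t')%N -> e < eucl_dist (r t) (r t').
  move=> tt'; apply: lt_le_trans (coord_le_eucl _ _ i).
  have [_ /andP[_ rt]] := Hr t; have [_ /andP[rt' _]] := Hr t'.
  have : level t + 2 * e <= level t'.
    rewrite /level -addrA lerD2l -{2}[2 * e]mulr1 -mulrDr ler_pM2l ?mulr_gt0 //.
    by rewrite natr1 ler_nat.
  move=> ltt'; rewrite distrC lter_normr; apply/orP; left; lra.
exists r; split=> [t|t t' tNt'].
  by have [pr _] := Hr t; exact: delta_equiv_trans pr.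
have [|] := ltnP t t'; first exact: sep.
rewrite leq_eqVlt => /orP[/eqP/val_inj/esym tt'|/sep]; first by rewrite tt' eqxx in tNt'.
by rewrite eucl_dist_sym.
Qed.

(** Without pockets the covering number gains a factor of order [1 / e] over the components, forcing
    the box dimension up to [g + 1]. *)
Lemma maximal_power_law_pocket : maximal_power_law dist F ->
  exists s I eta E, pocket s I eta E.
Proof.
move=> [g [g0 [c c1 pl] bd]]; apply: contrapT => noP.
have c0 : 0 < c by lra.
have c'0 : 0 < c^-1 / 4 by rewrite divr_gt0 // invr_gt0.
suff : g + 1 <= g by lra.
apply: (box_dim_ge c'0 _ bd) => e e01; have /andP[e0 _] := e01.
apply: covering_number_ge => n cov; rewrite -lee_fin.
apply: le_trans (no_pocket_covering_ge noP e01 cov).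
have [lo _] := pl e e01.
have -> : c^-1 / 4 * e `^ (- (g + 1)) = c^-1 * e `^ (- g) * (4 * e)^-1.
  rewrite opprD powRD; last by apply/implyP => _; rewrite gt_eqF.
  by rewrite powR_inv1 ?ltW //; field; rewrite !gt_eqF.
rewrite EFinM; apply: lee_wpmul2r => //.
by rewrite lee_fin invr_ge0 mulr_ge0 ?ltW.
Qed.

End FractalCube.

Theorem theorem1p1 (R : realType) (d m : nat) (hd : (1 <= d)%N) (hm : (2 <= m)%N)
    (D : {set 'rV['I_m]_d}) (hD : (2 <= #|D|)%N)
    (F : set 'rV[R]_d) (hF : is_fractal_cube D F) :
  maximal_power_law (@eucl_dist R d) F <-> has_trivial_point F.
Proof.
split=> [mpl|triv].
  have [s [I [eta [E P]]]] := maximal_power_law_pocket hF mpl.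
  have [s' [I' [eta' [E' isl]]]] := island_exists hm hF P.
  exact (island_trivial_point hm hF isl).
have [s [I [eta [E P]]]] := trivial_point_pocket hF triv.
have [s' [I' [eta' [E' isl]]]] := island_exists hm hF P.
exact (island_maximal_power_law hm hF hD hd isl).
Qed.
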